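(* There is a constant $c$ such that the following holds: if $M$ is an ordered matching on $2m$ vertices with interval chromatic number $2$ chosen uniformly at random, then $r_<(M,K_3)\le c\,m^{24/13}$ with high probability (i.e., with probability tending to $1$ as $m\to\infty$).
   Context: An ordered graph on $[N]$ is a graph with vertex set $\{1,\dots,N\}$ equipped with the natural order. Given a red/blue coloring of the edges of the complete graph on $[N]$, a red (ordered) copy of an ordered graph $G$ on $[p]$ is a strictly increasing map $\varphi:[p]\to[N]$ such that $\varphi(u)\varphi(v)$ is red for every edge $uv$ of $G$. The ordered Ramsey number $r_<(G,K_3)$ is the smallest $N$ such that every red/blue coloring of the edges of the complete graph on $[N]$ contains either a red ordered copy of $G$ or a blue triangle. The interval chromatic number of an ordered graph is the minimum number of contiguous intervals into which its vertex set can be split so that each interval is an independent set. Thus an ordered (perfect) matching on $[2m]$ with interval chromatic number $2$ is one in which every edge joins $[1,m]$ to $[m+1,2m]$; there are $m!$ such matchings, and uniform choice is among these. *)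

(* Defs.v *)
From mathcomp Require Import all_boot all_order all_fingroup.
From Stdlib Require Import Reals ClassicalEpsilon.

Set Implicit Arguments.
Unset Strict Implicit.
Unset Printing Implicit Defensive.

Definition asbool (P : Prop) : bool :=
  if excluded_middle_informative P then true else false.

(* An ordered graph on [p] is an edge relation on 'I_p (vertices 0..p-1 with the
   natural order).  Only the symmetric closure matters below. *)

(* A red/blue colouring of the complete graph on [N]: col x y for x < y,
   true = red, false = blue.  The colour of the unordered pair {x,y}: *)
Definition pair_col (N : nat) (col : 'I_N -> 'I_N -> bool) (x y : 'I_N) : bool :=
  if (x < y)%N then col x y else col y x.

Definition red_copy (p N : nat) (G : rel 'I_p) (col : 'I_N -> 'I_N -> bool) : Prop :=
  exists phi : 'I_p -> 'I_N,
    (forall u v : 'I_p, (u < v)%N -> (phi u < phi v)%N) /\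
    (forall u v : 'I_p, G u v -> pair_col col (phi u) (phi v)).

Definition blue_triangle (N : nat) (col : 'I_N -> 'I_N -> bool) : Prop :=
  exists a b c : 'I_N, (a < b)%N /\ (b < c)%N /\
    ~~ pair_col col a b /\ ~~ pair_col col a c /\ ~~ pair_col col b c.

Definition ramsey_K3 (p : nat) (G : rel 'I_p) (N : nat) : Prop :=
  forall col : 'I_N -> 'I_N -> bool, red_copy G col \/ blue_triangle col.

(* r_<(G, K_3) <= x, with r_< the least N having the Ramsey property:
   equivalently, some N <= x has the property. *)
Definition ord_ramsey_K3_le (p : nat) (G : rel 'I_p) (x : R) : Prop :=
  exists N : nat, (INR N <= x)%R /\ ramsey_K3 G N.

(* The ordered matching on [2m] with interval chromatic number 2 determined by
   a permutation s of 'I_m: vertex i < m is matched to vertex m + s i. *)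
Definition matching_of (m : nat) (s : 'S_m) : rel 'I_(m + m) :=
  fun u v =>
    [exists i : 'I_m,
      ((u == lshift m i) && (v == rshift m (s i))) ||
      ((v == lshift m i) && (u == rshift m (s i)))].

Definition prob_ramsey_le (m : nat) (x : R) : R :=
  (INR #|[set s : 'S_m | asbool (ord_ramsey_K3_le (matching_of s) x)]|
   / INR (m`!))%R.

(* Main.v *)
Require Import Defs.
From mathcomp Require Import all_boot all_order all_fingroup.
From Stdlib Require Import Reals Classical ClassicalEpsilon Lra.
From mathcomp Require Import zify.
(* Reals rebinds [_ ^ _] on [nat] to [Nat.pow]; this restores [expn]. *)
From mathcomp Require Import ssrnat.

(* In a colouring with no blue triangle and no red copy of the matching, every
   blue neighbourhood is a red clique, so blue degrees are below 2m.  Cut [N]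
   into 4m blocks of length b: the first 2m are rows, the last 2m are columns.
   A (row, column) pair is bad if it is entirely blue, and each row and each
   column has at most D ~ 2m / b bad pairs.

   For each shift th < m, embed greedily: go down the rows, sending left vertex
   i to the first row r that is not bad with column s(i) + th.  If no shift
   works, then every walk meets at least m bad pairs, and some stretch of q
   consecutive rows carries many of these over all shifts.  For a fixed row and
   index i only D shifts can be blocked, so the blocked walks must use indices
   spread over many groups of q consecutive i.  One shift th(k) for each such
   group k then yields at least m / (72 D^2) indices i for which s(i) + th(i / q)
   is a bad column of a row of the stretch, hence one of only q D values.

   Once the bad columns of the stretch (q D numbers) and the shifts (m / q
   numbers) are fixed, the proportion of permutations with H such indices is at
   most (q D)^H / H!.  With m of order w^26, D = w^4, q = 12 w^11, H = w^17, the
   union bound over (2m)^(q D + m/q + 1) choices gives probability at most 1/w,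
   and N is of order m^2 / D, that is m^(24/13). *)

Set Implicit Arguments.
Unset Strict Implicit.
Unset Printing Implicit Defensive.

(** * Permutations with many constrained values *)

(** Composing with the inverse of one such permutation [s0] gives permutations that fix [I]
    pointwise, hence move only points of its complement. *)
Lemma card_perm_agree (T : finType) (I : {set T}) (f : T -> T) :
  #|[set s : {perm T} | [forall i in I, s i == f i]]| <= (#|T| - #|I|)`!.
Proof.
case: (pickP [pred s : {perm T} | [forall i in I, s i == f i]]) => [s0 /= h0|none].
  have -> : #|T| - #|I| = #|~: I| by rewrite -(cardsC I) addKn.
  rewrite -card_perm -(card_imset _ (@mulIg _ s0^-1%g)); apply: subset_leq_card.
  apply/subsetP=> _ /imsetP[s + ->]; rewrite inE => /forall_inP hs.
  rewrite unfold_in; apply/subsetP=> x; rewrite inE => hx; rewrite inE.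
  apply: contra hx => xI; rewrite permM (eqP (hs x xI)).
  by rewrite -(eqP (forall_inP h0 x xI)) permK.
by rewrite eq_card0 // => s; rewrite inE; exact: none s.
Qed.

(** Permutations are sorted by their restriction to [I]: at most [a ^ #|I|] restrictions occur, and
    [card_perm_agree] bounds each class. *)
Lemma card_perm_constrained (T : finType) (A : T -> {set T}) (a : nat)
    (I : {set T}) :
  (forall i, #|A i| <= a) ->
  #|[set s : {perm T} | [forall i in I, s i \in A i]]| <=
    a ^ #|I| * (#|T| - #|I|)`!.
Proof.
move=> hA.
(* Restrictions are coded as total functions equal to the identity off [I], where each point
   contributes a factor 1. *)
pose F i := if i \in I then A i else [set i].
pose res (s : {perm T}) := [ffun i => if i \in I then s i else i].
rewrite -sum1_card (partition_big res (mem (finfun.family F))) /=; last first.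
  move=> s; rewrite inE => /forall_inP hs; apply/familyP=> i; rewrite ffunE /F.
  by case: ifP => iI; [exact: hs | rewrite inE].
have hF : #|finfun.family F| <= a ^ #|I|.
  rewrite card_family foldrE big_map -prod_nat_const [leqRHS]big_mkcond /=.
  rewrite [leqLHS]big_enum; apply: leq_prod => i _; rewrite /F.
  by case: ifP => _; rewrite ?expn1 ?cards1.
apply: (@leq_trans (\sum_(f in finfun.family F) (#|T| - #|I|)`!)).
  apply: leq_sum => f _; rewrite sum1dep_card.
  apply: leq_trans (card_perm_agree I f); apply: subset_leq_card.
  apply/subsetP=> s; rewrite !inE => /andP[_ /eqP <-].
  by apply/forall_inP=> i iI; rewrite ffunE iI.
by rewrite sum_nat_const leq_mul2r hF orbT.
Qed.

(** Union bound over the sets [I] of [H] hit positions; the binomial coefficient and the two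
    factorials combine into the factorial of [#|T|]. *)
Lemma card_perm_many_hits (T : finType) (A : T -> {set T}) (a H : nat) :
  (forall i, #|A i| <= a) ->
  #|[set s : {perm T} | H <= #|[set i | s i \in A i]|]| * H`! <= a ^ H * #|T|`!.
Proof.
move=> hA; have [hH|hH] := leqP H #|T|; last first.
  rewrite eq_card0 // => s; rewrite inE leqNgt.
  by rewrite (leq_ltn_trans (max_card _) hH).
pose S (I : {set T}) := [set s : {perm T} | [forall i in I, s i \in A i]].
have hsub : [set s : {perm T} | H <= #|[set i | s i \in A i]|] \subset
    \bigcup_(I : {set T} | #|I| == H) S I.
  apply/subsetP=> s; rewrite inE => hs.
  have [I hI cI] : exists2 I : {set T}, I \subset [set i | s i \in A i] & #|I| = H.
    exists [set x in take H (enum [set i | s i \in A i])].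
      by apply/subsetP=> x; rewrite inE => /mem_take; rewrite mem_enum.
    have u : uniq (take H (enum [set i | s i \in A i])).
      by rewrite take_uniq // enum_uniq.
    by rewrite cardsE (card_uniqP u) size_takel // -cardE.
  apply/bigcupP; exists I; rewrite ?cI // inE.
  by apply/forall_inP=> i iI; move/subsetP/(_ i iI): hI; rewrite inE.
have hU : #|\bigcup_(I : {set T} | #|I| == H) S I| <=
    'C(#|T|, H) * (a ^ H * (#|T| - H)`!).
  apply: (@leq_trans (\sum_(I : {set T} | #|I| == H) #|S I|)).
    elim/big_ind2: _ => [|x1 y1 x2 y2 h1 h2|//]; first by rewrite cards0.
    by rewrite (leq_trans (leq_card_setU _ _)) ?leq_add.
  rewrite -card_draws -sum_nat_const big_mkcond [leqRHS]big_mkcond /=.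
  apply: leq_sum => I _; rewrite inE; case: eqP => // <-.
  exact: card_perm_constrained.
rewrite -(bin_fact hH) mulnA.
apply: (@leq_trans ('C(#|T|, H) * (a ^ H * (#|T| - H)`!) * H`!)).
  by rewrite leq_mul2r (leq_trans (subset_leq_card hsub) hU) orbT.
by rewrite mulnCA -!mulnA leq_mul2l orbC; lia.
Qed.

Lemma leq_expn_ffact (a n : nat) : a ^ n <= (a + n) ^_ n.
Proof.
elim: n => [|n IH] //; rewrite addnS ffactSS expnS leq_mul //.
by rewrite leqW // leq_addr.
Qed.

Lemma leq_bin_exp2 (n k : nat) : 'C(n, k) <= 2 ^ n.
Proof.
elim: n k => [[|k]|n IH [|k]] //; first by rewrite bin0 expn_gt0.
by rewrite binS expnS mul2n -addnn leq_add.
Qed.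

(** A crude Stirling bound: the power is at most a falling factorial of [n + n], which is a central
    binomial coefficient times the factorial of [n]. *)
Lemma leq_expn_self_fact (n : nat) : n ^ n <= 4 ^ n * n`!.
Proof.
rewrite (leq_trans (leq_expn_ffact n n)) // -bin_ffact leq_mul2r.
by rewrite (leq_trans (leq_bin_exp2 _ _)) ?orbT // -[4]/(2 ^ 2) -expnM addnn -mul2n.
Qed.

(** * Greedy walks *)

(* [walk h n] is the index reached before row [n] by a walk that stays on an index
   while [h] blocks it and moves on to the next index otherwise. *)
Fixpoint walk (h : nat -> nat -> bool) (n : nat) : nat :=
  if n is r.+1 then walk h r + ~~ h r (walk h r) else 0.

Lemma walk_hits (h : nat -> nat -> bool) (n : nat) :
  \sum_(r < n) h r (walk h r) + walk h n = n.
Proof.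
elim: n => [|n IH]; first by rewrite big_ord0.
rewrite big_ord_recr /= addnACA IH.
by case: (h n _) => /=; rewrite ?addn0 ?addn1.
Qed.

Lemma walk_bounds (h : nat -> nat -> bool) (n k : nat) :
  walk h n <= walk h (n + k) <= walk h n + k.
Proof.
elim: k => [|k IH]; first by rewrite !addn0 leqnn.
by rewrite !addnS /=; case: (h _ _) => /=; lia.
Qed.

Lemma walk_mono (h : nat -> nat -> bool) : {homo walk h : n p / n <= p}.
Proof. by move=> n p /subnKC <-; case/andP: (walk_bounds h n (p - n)). Qed.

(** Take for [r] the row at which the walk leaves [i]; this row will host left vertex [i]. *)
Lemma walk_exit (h : nat -> nat -> bool) (n i : nat) :
  i < walk h n -> exists2 r, r < n & (walk h r = i) /\ ~~ h r i.
Proof.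
elim: n => [|n IH] //= hi; have [/IH[r rn hr]|ge] := ltnP i (walk h n).
  by exists r => //; exact: ltnW.
exists n => //; case E: (h n (walk h n)) hi => /= hi; first by lia.
have -> : i = walk h n by lia.
by rewrite E.
Qed.

Lemma sum_nat_mul_block (F : nat -> nat) (P q : nat) :
  \sum_(i < P * q) F i = \sum_(u < P) \sum_(r < q) F (u * q + r).
Proof.
elim: P => [|P IH]; first by rewrite mul0n !big_ord0.
rewrite big_ord_recr /= -IH mulSnr -!(big_mkord xpredT F).
rewrite (@big_cat_nat _ _ _ (P * q) 0 (P * q + q)) ?leq_addr //=; congr (_ + _).
rewrite -{1}[P * q]add0n big_addn addKn big_mkord.
by apply: eq_bigr => i _; rewrite addnC.
Qed.

Lemma leq_sum_ord_const (n C : nat) (F : 'I_n -> nat) :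
  (forall i, F i <= C) -> \sum_(i < n) F i <= n * C.
Proof.
move=> hF; rewrite -[n in leqRHS]card_ord -sum_nat_const.
by apply: leq_sum => i _; exact: hF.
Qed.

Lemma sum_ord_eq_le1 (n a x : nat) : \sum_(j < n) (a + j == x) <= 1.
Proof.
rewrite -big_mkcond sum1dep_card; apply/card_le1_eqP => i j.
by rewrite !inE => /eqP hi /eqP hj; apply: ord_inj; lia.
Qed.

Lemma exists_ge_average (n x : nat) (F : nat -> nat) :
  0 < n -> x <= \sum_(i < n) F i -> exists2 i, i < n & x <= n * F i.
Proof.
move=> n0 hx; case: (pickP (fun i : 'I_n => x <= n * F i)) => [i hi|no].
  by exists i.
have : n * x <= n * \sum_(i < n) F i by rewrite leq_mul2l hx orbT.
rewrite big_distrr /= => h.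
suff : \sum_(i < n) n * F i < n * x by rewrite ltnNge h.
have -> : n * x = \sum_(i < n) x by rewrite sum_nat_const card_ord.
case: n n0 no {hx h} => // n _ no.
rewrite big_ord_recl [ltnRHS]big_ord_recl -addSn leq_add //.
  by rewrite ltnNge no.
by apply: leq_sum => i _; rewrite ltnW // ltnNge no.
Qed.

(** Averaging over stretches finds one with many hits over all shifts. Groups that are light for
    every shift absorb few of them, so many groups are heavy for some shift; [th] records that shift
    group by group. *)
Lemma failing_walks_certificate (m q tau D : nat) (B : nat -> nat -> bool)
    (s : nat -> nat) :
  q = 12 * tau -> 0 < tau -> 0 < D -> q <= m ->
  (forall i, s i < m) ->
  (forall r c, B r c -> r < m + m) ->
  (forall r a n, \sum_(j < n) B r (a + j) <= D) ->
  (forall c a n, \sum_(j < n) B (a + j) c <= D) ->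
  (forall th, th < m -> walk (fun r i => B r (s i + th)) (m + m) < m) ->
  exists (a : nat) (th : nat -> nat), (forall k, th k < m) /\
    m <= 72 * D ^ 2 *
      #|[set i : 'I_m | [exists r : 'I_q, B (a + r) (s i + th (i %/ q))]]|.
Proof.
move=> eq_q tau0 D0 le_qm s_lt B_row rowD colD fail.
have m0 : 0 < m by lia.
have q0 : 0 < q by lia.
pose h th r i := B r (s i + th).
pose hit th r := h th r (walk (h th) r).
(* Rounding up makes the [P] stretches cover all [m + m] rows, while [q <= m] keeps their total
   length at most [3 * m]. *)
pose P := ((m + m) %/ q).+1.
have le_P : m + m <= P * q by rewrite /P ltnW // ltn_ceil.
have P_le : P * q <= 3 * m.
  by rewrite /P mulSn -(leq_add2l q) [q + 3 * m]addnC; have := leq_divM (m + m) q; lia.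
have hits_th th : th < m -> m <= \sum_(r < P * q) hit th r.
  move=> /fail lt_m; have := walk_hits (h th) (P * q).
  have := walk_bounds (h th) (m + m) (P * q - (m + m)).
  rewrite subnKC //; rewrite -/(h th) in lt_m; move: lt_m.
  by rewrite -/(hit th); set S := \sum_(r < _) _; lia.
have [sg _ hsg] : exists2 sg, sg < P &
    m * m <= P * \sum_(th < m) \sum_(r < q) hit th (sg * q + r).
  apply: (@exists_ge_average P (m * m)
    (fun sg => \sum_(th < m) \sum_(r < q) hit th (sg * q + r))) => //.
  rewrite exchange_big /=.
  rewrite (_ : m * m = \sum_(th < m) m); last by rewrite sum_nat_const card_ord.
  by apply: leq_sum => th _; rewrite -(sum_nat_mul_block (fun r => hit th r)) hits_th.
pose p th r := walk (h th) (sg * q + r).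
pose g k th := \sum_(r < q) (hit th (sg * q + r) && (p th r %/ q == k)).
pose G := (m %/ q).+1.
have hit_G th (r : nat) : th < m -> hit th (sg * q + r) -> p th r %/ q < G.
  move=> tm hr; rewrite ltnS leq_div2r // ltnW //.
  apply: leq_ltn_trans (fail th tm); apply: walk_mono; apply: ltnW.
  exact: B_row hr.
(* The heavy groups: some shift has at least [tau] hits there within the stretch [sg]. *)
pose K := [set k : 'I_G | [exists th : 'I_m, tau <= g k th]].
have hit_le th : th < m ->
    \sum_(r < q) hit th (sg * q + r) <= \sum_(k < G) g k th.
  move=> tm; rewrite exchange_big /=; apply: leq_sum => r _.
  case E: (hit th _) => //=; rewrite (bigD1 (Ordinal (hit_G th r tm E))) //=.
  by rewrite eqxx leq_addr.
(* Each row and index in group [k] are blocked for at most [D] shifts. *)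
have heavy_le k : \sum_(th < m) g k th <= q * q * D.
  rewrite exchange_big /=.
  rewrite -mulnA; apply: leq_sum_ord_const => r.
  apply: (@leq_trans (\sum_(j < q) \sum_(th < m) B (sg * q + r) (s (k * q + j) + th))).
    rewrite exchange_big; apply: leq_sum => th _ /=.
    case E: (hit _ _ && _) => //; case/andP: E => hr /eqP hk.
    rewrite (bigD1 (Ordinal (ltn_pmod (p th r) q0))) //= -hk -divn_eq.
    by move: hr; rewrite /hit /h /p => ->; rewrite leq_addr.
  by apply: leq_sum_ord_const => j; exact: rowD.
(* During a stretch of [q] rows the walk visits at most two groups of indices. *)
have light_le th : th < m -> \sum_(k < G | k \notin K) g k th <= 2 * tau.
  move=> tm; pose k0 := p th 0 %/ q.
  apply: (@leq_trans (\sum_(k < G) (tau * (nat_of_ord k == k0) + tau * (nat_of_ord k == k0.+1)))).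
    rewrite big_mkcond; apply: leq_sum => k _; case: ifP => // kK.
    have gk : g k th <= tau.
      apply: ltnW; rewrite ltnNge; apply: contra kK => hk.
      by rewrite inE; apply/existsP; exists (Ordinal tm).
    have [E|n0] := eqVneq (nat_of_ord k) k0.
      by rewrite (leq_trans gk) // muln1 leq_addr.
    have [E|n1] := eqVneq (nat_of_ord k) k0.+1.
      by rewrite (leq_trans gk) // muln1 leq_addl.
    rewrite /g big1 // => r _; case: eqP => [E|]; last by rewrite andbF.
    have := walk_bounds (h th) (sg * q + 0) r.
    rewrite addn0 -/(p th r) => /andP[b1 b2].
    have c1 : k0 <= p th r %/ q by rewrite /k0 leq_div2r // /p addn0.
    have c2 : p th r %/ q <= k0.+1.
      rewrite /k0 -add1n -divnMDl // mul1n leq_div2r // addnC.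
      by rewrite /p addn0 (leq_trans b2) // leq_add2l ltnW.
    by move: n0 n1 c1 c2; rewrite E; lia.
  have one (x : nat) : \sum_(k < G) tau * (nat_of_ord k == x) <= tau.
    by rewrite -big_distrr -[leqRHS]muln1 leq_mul2l (sum_ord_eq_le1 G 0) orbT.
  by rewrite big_split mul2n -addnn leq_add.
have K_large : m <= 6 * #|K| * q * D.
  have split_le : \sum_(th < m) \sum_(r < q) hit th (sg * q + r) <=
      #|K| * (q * q * D) + m * (2 * tau).
    apply: (@leq_trans (\sum_(k in K) \sum_(th < m) g k th +
                        \sum_(th < m) \sum_(k < G | k \notin K) g k th)).
      rewrite [X in _ <= X + _]exchange_big -big_split /=; apply: leq_sum => th _.
      apply: leq_trans (hit_le _ (ltn_ord th)) _.
      by rewrite [leqLHS](bigID (mem K)).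
    apply: leq_add; last by apply: leq_sum_ord_const => th; exact: light_le.
    by rewrite -sum_nat_const; apply: leq_sum => k _; exact: heavy_le.
  move: split_le hsg; set S := \sum_(th < m) _ => split_le hsg.
  have h1 : m * q <= 3 * S.
    rewrite -(leq_pmul2l m0) mulnA (leq_trans (leq_mul hsg (leqnn q))) //.
    by rewrite mulnAC mulnA [m * 3]mulnC leq_mul2r P_le orbT.
  (* Since [q = 12 * tau], the light part [3 * (m * (2 * tau))] is exactly half of [m * q] and is
     absorbed. *)
  have h2 : m * q <= 6 * #|K| * q * D * q.
    by move: h1 split_le; rewrite eq_q; nia.
  by move: h2; rewrite leq_pmul2r.
pose th0 : 'I_m := Ordinal m0.
(* A heavy group gets a shift witnessing its heaviness; the other groups get the default [th0]. *)
pose th k := odflt th0 [pick t : 'I_m | tau <= g k t].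
have thP (k : 'I_G) : k \in K -> tau <= g k (th k).
  rewrite inE => /existsP[t ht]; rewrite /th; case: pickP => //= /(_ t).
  by rewrite ht.
exists (sg * q), (fun k => th k); split; first by move=> k; exact: ltn_ord.
set I := [set i : 'I_m | _].
(* A column blocks at most [D] rows, so [tau] blocked rows involve at least
   [tau / D] different indices. *)
have fiber (k : 'I_G) : k \in K -> tau <= D * #|[set i in I | i %/ q == k]|.
  move=> kK; apply: (leq_trans (thP k kK)).
  apply: (@leq_trans (\sum_(i in [set i in I | i %/ q == k])
                        \sum_(r < q) B (sg * q + r) (s i + th k))).
    rewrite exchange_big; apply: leq_sum => r _ /=.
    case E: (hit _ _ && _) => //; case/andP: E => hr /eqP hk.
    have pm : p (th k) r < m.
      apply: leq_ltn_trans (fail (th k) (ltn_ord _)); apply: walk_mono.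
      by apply: ltnW; exact: B_row hr.
    rewrite (bigD1 (Ordinal pm)) /=; last first.
      rewrite !inE /= hk eqxx andbT; apply/existsP; exists r.
      exact: hr.
    by move: hr; rewrite /hit /h /p => ->; rewrite leq_addr.
  by rewrite [leqRHS]mulnC -sum_nat_const; apply: leq_sum => i _; exact: colD.
have fibers : #|K| * tau <= D * #|I|.
  apply: (@leq_trans (\sum_(k in K) D * #|[set i in I | i %/ q == k]|)).
    by rewrite -sum_nat_const; apply: leq_sum => k; exact: fiber.
  rewrite -big_distrr leq_mul2l /=; apply/orP; right.
  apply: (@leq_trans (\sum_(k < G) #|[set i in I | i %/ q == k]|)).
    by rewrite big_mkcond; apply: leq_sum => k _; case: ifP.
  have iG (i : 'I_m) : i %/ q < G by rewrite ltnS leq_div2r // ltnW.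
  rewrite -[leqRHS]sum1_card (partition_big (fun i => Ordinal (iG i)) xpredT) //=.
  apply: leq_sum => k _; rewrite -sum1_card; apply: eq_leq; apply: eq_bigl => i.
  by rewrite !inE.
(* The constant 72 is the 6 of [K_large] times the 12 of [q = 12 * tau]. *)
apply: (leq_trans K_large); rewrite eq_q -mulnn.
by move: fibers; nia.
Qed.

(** * Blue neighbourhoods and blue blocks *)

Lemma pair_colC (N : nat) (col : 'I_N -> 'I_N -> bool) (x y : 'I_N) :
  x != y -> pair_col col x y = pair_col col y x.
Proof.
rewrite /pair_col => ne; case: (ltngtP x y) => // e.
by case/eqP: ne; apply: val_inj.
Qed.

Lemma blue_triangle_of_distinct (N : nat) (col : 'I_N -> 'I_N -> bool)
    (x y z : 'I_N) :
  x != y -> x != z -> y != z -> ~~ pair_col col x y -> ~~ pair_col col x z ->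
  ~~ pair_col col y z -> blue_triangle col.
Proof.
move=> xy xz yz; wlog lt_xy : x y xy xz yz / x < y.
  move=> H hxy hxz hyz; case: (ltngtP x y) => lt_xy.
  - exact: (H x y).
  - by apply: (H y x) => //; rewrite 1?eq_sym // pair_colC // eq_sym.
  - by case/eqP: xy; apply: val_inj.
move=> hxy hxz hyz; case: (ltngtP y z) => lt_yz; last by case/eqP: yz; apply: val_inj.
  by exists x, y, z.
case: (ltngtP x z) => lt_xz; last by case/eqP: xz; apply: val_inj.
  by exists x, z, y; do !split => //; rewrite pair_colC // eq_sym.
by exists z, x, y; do !split => //; rewrite pair_colC // eq_sym.
Qed.

Lemma increasing_enumeration (N p : nat) (S : {set 'I_N}) :
  p <= #|S| -> exists phi : 'I_p -> 'I_N,
    (forall u v : 'I_p, u < v -> phi u < phi v) /\ (forall u, phi u \in S).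
Proof.
move=> pS; exists (fun u => enum_val (widen_ord pS u)); split; last first.
  by move=> u; exact: enum_valP.
move=> u v uv; pose x0 := enum_val (widen_ord pS u).
rewrite (enum_val_nth x0 (widen_ord pS u)) (enum_val_nth x0 (widen_ord pS v)) /=.
have srt : sorted (fun x y : 'I_N => x < y) (enum S).
  rewrite /enum_mem; apply: sorted_filter; first by move=> ???; exact: ltn_trans.
  have := iota_ltn_sorted 0 N; rewrite -val_enum_ord sorted_map enumT.
  by [].
apply: (sorted_ltn_nth _ x0 srt) => //; first by move=> ???; exact: ltn_trans.
  by rewrite inE -cardE (leq_trans _ pS).
by rewrite inE -cardE (leq_trans _ pS).
Qed.

(** Any [p] vertices of a red clique, taken in increasing order, carry a red copy of [G]. Loops are
    excluded because [pair_col] is arbitrary on the diagonal. *)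
Lemma blue_degree_lt (p N : nat) (G : rel 'I_p) (col : 'I_N -> 'I_N -> bool)
    (v : 'I_N) :
  (forall i, ~~ G i i) -> ~ red_copy G col -> ~ blue_triangle col ->
  #|[set x | (x != v) && ~~ pair_col col v x]| < p.
Proof.
move=> irr no_red no_blue; rewrite ltnNge; apply/negP => /increasing_enumeration.
case=> phi [incr phiS]; apply: no_red; exists phi; split=> // i j Gij.
have ij : phi i != phi j.
  apply/negP => /eqP e; case: (ltngtP i j) => [/incr|/incr|/val_inj eij].
  - by rewrite e ltnn.
  - by rewrite e ltnn.
  - by move: Gij; rewrite eij (negPf (irr j)).
apply: contraT => blue; case: no_blue.
move: (phiS i) (phiS j); rewrite !inE => /andP[iv bi] /andP[jv bj].
by apply: (@blue_triangle_of_distinct _ _ v (phi i) (phi j)); rewrite // eq_sym.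
Qed.

(** Distinct blocks are disjoint, and each selected block lies wholly inside [[N]], so it
    contributes [b] elements to [S]. *)
Lemma full_blocks_le (N b a n : nat) (S : {set 'I_N}) (Q : nat -> bool) :
  0 < b -> (forall c, Q c -> c.+1 * b <= N) ->
  (forall c (x : 'I_N), Q c -> x %/ b = c -> x \in S) ->
  (\sum_(j < n) Q (a + j)) * b <= #|S|.
Proof.
move=> b0 QN QS; rewrite big_distrl /=.
apply: (@leq_trans (\sum_(j < n) #|[set x in S | a + j == x %/ b]|)).
  apply: leq_sum => j _; case E: (Q (a + j)) => //; rewrite mul1n.
  have lt (o : 'I_b) : (a + j) * b + o < N.
    by have := QN _ E; have := ltn_ord o; lia.
  pose f (o : 'I_b) : 'I_N := Ordinal (lt o).
  have injf : injective f.
    by move=> o o' /(congr1 val) /= /addnI; exact: val_inj.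
  rewrite -[leqLHS]card_ord -(card_imset _ injf); apply: subset_leq_card.
  apply/subsetP=> _ /imsetP[o _ ->]; rewrite inE.
  have fo : f o %/ b = a + j by rewrite /= divnMDl // divn_small ?addn0.
  by rewrite (QS _ _ E fo) fo eqxx.
rewrite -[leqRHS]sum1_card.
apply: (@leq_trans (\sum_(x in S) \sum_(j < n) (a + j == x %/ b))).
  rewrite exchange_big /=; apply: leq_sum => j _.
  rewrite -sum1_card big_mkcond [leqRHS]big_mkcond; apply: leq_sum => x _.
  by rewrite !inE; case: (x \in S) => //; case: eqP.
by apply: leq_sum => x _; exact: sum_ord_eq_le1.
Qed.

(* Row [r] is the block of vertices [x] with [x %/ b = r], and column [c] the one
   with [x %/ b = m + m + c]. *)
Definition blue_block (m b N : nat) (col : 'I_N -> 'I_N -> bool) (r c : nat) : bool :=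
  [&& r < m + m, c < m + m &
    [forall x : 'I_N, forall y : 'I_N,
      (x %/ b == r) ==> (y %/ b == m + m + c) ==> ~~ pair_col col x y]].

Lemma blue_blockP (m b N : nat) (col : 'I_N -> 'I_N -> bool) (r c : nat) (x y : 'I_N) :
  blue_block m b col r c -> x %/ b = r -> y %/ b = m + m + c ->
  x != y /\ ~~ pair_col col x y.
Proof.
case/and3P=> rm _ /forallP/(_ x)/forallP/(_ y)/implyP h xr yc; split; last first.
  by have /implyP := h (introT eqP xr); apply; apply/eqP.
by apply/eqP => e; move: yc; rewrite -e xr; lia.
Qed.

(** The first vertex of the row is blue to every vertex of each bad column, so its blue degree
    limits the number of these columns. *)
Lemma blue_block_row (m b D N : nat) (col : 'I_N -> 'I_N -> bool) (r a n : nat) :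
  0 < b -> m + m <= D * b -> N = (m + m + (m + m)) * b ->
  (forall v, #|[set x | (x != v) && ~~ pair_col col v x]| < m + m) ->
  \sum_(j < n) blue_block m b col r (a + j) <= D.
Proof.
move=> b0 hD eN deg; have [rm|rm] := ltnP r (m + m); last first.
  by rewrite big1 // => j _; rewrite /blue_block ltnNge rm.
have vN : r * b < N by rewrite eN ltn_pmul2r // (leq_trans rm) // leq_addr.
pose v : 'I_N := Ordinal vN.
(* [Q] is indexed by blocks of [[N]], where column [c] is block [m + m + c]. *)
pose Q c := (m + m <= c) && blue_block m b col r (c - (m + m)).
have := @full_blocks_le N b (m + m + a) n [set x | (x != v) && ~~ pair_col col v x] Q b0.
have -> : \sum_(j < n) Q (m + m + a + j) = \sum_(j < n) blue_block m b col r (a + j).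
  by apply: eq_bigr => j _; rewrite /Q -addnA leq_addr addKn.
move=> H; have {}H := leq_ltn_trans (H _ _) (deg v).
rewrite -ltnS -(ltn_pmul2r b0) (leq_trans (H _ _)) //.
- by move=> c /andP[mc /and3P[_ cm _]]; rewrite eN leq_mul2r; lia.
- move=> c x /andP[mc hc] xc; rewrite inE eq_sym; apply/andP.
  by apply: (blue_blockP hc); rewrite /= ?mulnK // subnKC.
by rewrite (leq_trans hD) // leq_mul2r leqnSn orbT.
Qed.

Lemma blue_block_col (m b D N : nat) (col : 'I_N -> 'I_N -> bool) (c a n : nat) :
  0 < b -> m + m <= D * b -> N = (m + m + (m + m)) * b ->
  (forall v, #|[set x | (x != v) && ~~ pair_col col v x]| < m + m) ->
  \sum_(j < n) blue_block m b col (a + j) c <= D.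
Proof.
move=> b0 hD eN deg; have [cm|cm] := ltnP c (m + m); last first.
  by rewrite big1 // => j _; rewrite /blue_block ltnNge [c < _]ltnNge cm andbF.
have vN : (m + m + c) * b < N by rewrite eN ltn_pmul2r // ltn_add2l.
pose v : 'I_N := Ordinal vN.
have H := @full_blocks_le N b a n [set x | (x != v) && ~~ pair_col col v x]
  (fun r => blue_block m b col r c) b0.
have {}H := leq_ltn_trans (H _ _) (deg v).
rewrite -ltnS -(ltn_pmul2r b0) (leq_trans (H _ _)) //.
- by move=> r /and3P[rm _ _]; rewrite eN leq_mul2r (leq_trans rm) ?leq_addr ?orbT.
- move=> r x hr xr; rewrite inE.
  have vc : v %/ b = m + m + c by rewrite /= mulnK.
  by have [ne hb] := blue_blockP hr xr vc; rewrite ne pair_colC // eq_sym.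
by rewrite (leq_trans hD) // leq_mul2r leqnSn orbT.
Qed.

(** * Red copies from successful walks *)

Lemma lt_of_block_lt (b N : nat) (x y : 'I_N) : x %/ b < y %/ b -> x < y.
Proof. by move=> h; rewrite ltnNge; apply: contraL h => h; rewrite -leqNgt leq_div2r. Qed.

(** Each index leaves the walk at a row not bad with its column, which supplies a red pair. Left
    vertices increase because the walk is monotone, right vertices because a common shift preserves
    the order of the values of [s]. With [th < m], [m + m] columns suffice. *)
Lemma red_copy_of_walk (m b N : nat) (col : 'I_N -> 'I_N -> bool) (s : 'S_m)
    (sn : nat -> nat) (th : nat) :
  (forall i : 'I_m, sn i = s i) -> th < m ->
  m <= walk (fun r i => blue_block m b col r (sn i + th)) (m + m) ->
  red_copy (matching_of s) col.
Proof.
move=> sE thm; set h := (fun r i => _) => reach.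
have /fin_all_exists[f hf] (i : 'I_m) : exists u : nat * ('I_N * 'I_N),
    [/\ walk h u.1 = i, u.1 < m + m, u.2.1 %/ b = u.1,
        u.2.2 %/ b = m + m + (s i + th) & pair_col col u.2.1 u.2.2].
  have [r rm [wr hr]] := walk_exit (leq_trans (ltn_ord i) reach).
  move: hr; rewrite {1}/h /blue_block sE rm (_ : s i + th < m + m) /=; last first.
    by have := ltn_ord (s i); lia.
  case/forallPn=> x /forallPn[y]; rewrite negb_imply => /andP[/eqP xr].
  by rewrite negb_imply negbK => /andP[/eqP yc hxy]; exists (r, (x, y)).
pose phi (u : 'I_(m + m)) := match fintype.split u with
  | inl i => (f i).2.1 | inr j => (f (s^-1 j)%g).2.2 end.
have phil i : phi (lshift m i) = (f i).2.1 by rewrite /phi -[lshift m i]/(unsplit (inl i)) unsplitK.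
have phir i : phi (rshift m (s i)) = (f i).2.2.
  by rewrite /phi -[rshift m (s i)]/(unsplit (inr (s i))) unsplitK permK.
have edge i : pair_col col (phi (lshift m i)) (phi (rshift m (s i))).
  by rewrite phil phir; case: (hf i).
have lt_lr i j : phi (lshift m i) < phi (rshift m (s j)).
  rewrite phil phir; apply: (@lt_of_block_lt b).
  by case: (hf i) => _ ri -> _ _; case: (hf j) => _ _ _ -> _; lia.
exists phi; split=> [u v|u v /existsP[i /orP[]/andP[/eqP-> /eqP->]]]; last 2 first.
- exact: edge.
- rewrite pair_colC; first exact: edge.
  by apply/eqP=> e; have := lt_lr i i; rewrite e ltnn.
case: (split_ordP u) => i ->; case: (split_ordP v) => j -> /=.
- move=> ij; rewrite !phil; apply: (@lt_of_block_lt b).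
  case: (hf i) => wi _ -> _ _; case: (hf j) => wj _ -> _ _.
  by rewrite ltnNge; apply: contraL ij => /(walk_mono h); rewrite wi wj leqNgt.
- by move=> _; rewrite -[j](permKV s); exact: lt_lr.
- by have := ltn_ord j; lia.
rewrite ltn_add2l => ij; rewrite -[i](permKV s) -[j](permKV s) !phir.
apply: (@lt_of_block_lt b); case: (hf (s^-1 i)%g) => _ _ _ -> _.
by case: (hf (s^-1 j)%g) => _ _ _ -> _; rewrite !permKV; lia.
Qed.

(* [F] lists the bad columns of a stretch of [q] rows and [th] gives the shift used
   for each group of [q] consecutive indices. *)
Definition allowed (m q D : nat) (F : {ffun 'I_q * 'I_D -> 'I_(m + m)})
    (th : {ffun 'I_(m %/ q).+1 -> 'I_m}) (i : 'I_m) : {set 'I_m} :=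
  [set v : 'I_m | [exists p, v + th (inord (i %/ q)) == F p]].

Lemma card_allowed (m q D : nat) (F : {ffun 'I_q * 'I_D -> 'I_(m + m)})
    (th : {ffun 'I_(m %/ q).+1 -> 'I_m}) (i : 'I_m) :
  #|allowed F th i| <= q * D.
Proof.
set t := th (inord (i %/ q)).
(* Each entry [F p] permits at most the value [F p - t]; [insubd] replaces a difference outside the
   range by [i]. *)
apply: (@leq_trans #|[set insubd i (F p - t) | p in [set: 'I_q * 'I_D]]|).
  apply: subset_leq_card; apply/subsetP=> v; rewrite inE => /existsP[p /eqP vp].
  by apply/imsetP; exists p; rewrite ?inE // -vp addnK; apply: val_inj; rewrite val_insubd ltn_ord.
by rewrite (leq_trans (leq_imset_card _ _)) // cardsT card_prod !card_ord.
Qed.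

(** This makes the certificate finite data that can be counted: [F] stores the bad columns
    themselves, so the start [a] of the stretch need not be recorded. *)
Lemma not_ramsey_certificate (m q tau D b : nat) (s : 'S_m) :
  q = 12 * tau -> 0 < tau -> 0 < D -> q <= m -> 0 < b -> m + m <= D * b ->
  ~ ramsey_K3 (matching_of s) ((m + m + (m + m)) * b) ->
  exists (F : {ffun 'I_q * 'I_D -> 'I_(m + m)})
         (th : {ffun 'I_(m %/ q).+1 -> 'I_m}),
    m <= 72 * D ^ 2 * #|[set i | s i \in allowed F th i]|.
Proof.
move=> eq_q tau0 D0 le_qm b0 hD /not_all_ex_not[col /not_or_and[no_red no_blue]].
have m0 : 0 < m by lia.
pose sn i : nat := if insub i is Some j then s j else 0.
have snE (i : 'I_m) : sn i = s i by rewrite /sn valK.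
have sn_lt i : sn i < m by rewrite /sn; case: insub.
have irr (i : 'I_(m + m)) : ~~ matching_of s i i.
  by apply/existsPn=> j; apply/negP=> /orP[]/andP[/eqP->]; rewrite eq_lrshift.
have deg v := blue_degree_lt v irr no_red no_blue.
pose B := blue_block m b col.
have rowB r a n : \sum_(j < n) B r (a + j) <= D by exact: blue_block_row.
have colB c a n : \sum_(j < n) B (a + j) c <= D by exact: blue_block_col.
have supp r c : B r c -> r < m + m by case/and3P.
have fail th : th < m -> walk (fun r i => B r (sn i + th)) (m + m) < m.
  by move=> thm; rewrite ltnNge; apply/negP => /(red_copy_of_walk snE thm).
have [a [th [th_lt hI]]] :=
  failing_walks_certificate eq_q tau0 D0 le_qm sn_lt supp rowB colB fail.
have x0 : 'I_(m + m) by apply: (@Ordinal _ 0); rewrite addn_gt0 m0.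
pose N r := [set c : 'I_(m + m) | B r c].
(* By [rowB] a row has at most [D] bad columns; [x0] pads shorter lists. *)
exists [ffun p : 'I_q * 'I_D => nth x0 (enum (N (a + p.1))) p.2].
exists [ffun k : 'I_(m %/ q).+1 => Ordinal (th_lt k)].
apply: (leq_trans hI); rewrite leq_mul2l; apply/orP; right.
apply: subset_leq_card; apply/subsetP=> i; rewrite !inE => /existsP[r hr].
rewrite snE in hr.
have c_lt : s i + th (i %/ q) < m + m.
  by case/and3P: hr.
have cN : Ordinal c_lt \in enum (N (a + r)) by rewrite mem_enum inE.
have d_lt : index (Ordinal c_lt) (enum (N (a + r))) < D.
  apply: (@leq_trans (size (enum (N (a + r))))); first by rewrite index_mem.
  rewrite -cardE -sum1_card big_mkcond /=.
  apply: leq_trans (rowB (a + r) 0 (m + m)); apply: leq_sum => c _.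
  by rewrite inE add0n; case: (B _ _).
apply/existsP; exists (r, Ordinal d_lt); rewrite !ffunE /= nth_index //=.
by rewrite inordK // ltnS leq_div2r // ltnW.
Qed.

(** * Counting *)

Lemma leq_card_bigcup (I T : finType) (A : I -> {set T}) (n : nat) :
  (forall i, #|A i| <= n) -> #|\bigcup_i A i| <= #|I| * n.
Proof.
move=> hA; rewrite -sum_nat_const; apply: (@leq_trans (\sum_i #|A i|)); last first.
  by apply: leq_sum.
elim/big_ind2: _ => [|x1 y1 x2 y2 h1 h2|//]; first by rewrite cards0.
by rewrite (leq_trans (leq_card_setU _ _)) ?leq_add.
Qed.

(** Union bound over [F] and [th], with [card_perm_many_hits] applied to sets of size at most
    [q * D]. *)
Lemma card_certified (m q D H : nat) :
  #|[set s : 'S_m | [exists F : {ffun 'I_q * 'I_D -> 'I_(m + m)},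
      exists th : {ffun 'I_(m %/ q).+1 -> 'I_m},
      H <= #|[set i | s i \in allowed F th i]|]]| * H`! <=
  (m + m) ^ (q * D) * (m ^ (m %/ q).+1 * ((q * D) ^ H * m`!)).
Proof.
set Z := [set s | _].
pose Y (F : {ffun 'I_q * 'I_D -> 'I_(m + m)}) (th : {ffun 'I_(m %/ q).+1 -> 'I_m}) :=
  [set s : 'S_m | H <= #|[set i | s i \in allowed F th i]|].
have hY F th : #|Y F th| <= ((q * D) ^ H * m`!) %/ H`!.
  rewrite leq_divRL ?fact_gt0 //.
  by have := card_perm_many_hits H (card_allowed F th); rewrite card_ord.
have sZ : Z \subset \bigcup_F \bigcup_th Y F th.
  apply/subsetP=> s; rewrite inE => /existsP[F /existsP[th hs]].
  by apply/bigcupP; exists F => //; apply/bigcupP; exists th; rewrite ?inE.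
have := subset_leq_card sZ.
move/leq_trans/(_ (leq_card_bigcup (fun F => leq_card_bigcup (hY F)))).
rewrite !card_ffun card_prod !card_ord => hZ.
rewrite -(leq_pmul2r (fact_gt0 H)) in hZ; apply: (leq_trans hZ).
by rewrite -!mulnA !leq_mul2l leq_divM !orbT.
Qed.

(** * Choice of parameters *)

Lemma root_floor (k m : nat) : 0 < k -> exists w, w ^ k <= m < w.+1 ^ k.
Proof.
move=> k0; elim: m => [|m [w /andP[h1 h2]]].
  by exists 0; rewrite exp0n // exp1n.
have [lt|ge] := ltnP m.+1 (w.+1 ^ k); first by exists w; rewrite lt ltnW.
by exists w.+1; rewrite ge (leq_ltn_trans h2) // ltn_exp2r.
Qed.

(** Up to a constant, [m] becomes a perfect power, so that all parameters can be powers of [w]. For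
    [w > 0], doubling [w] exceeds or equals [w.+1], whence [C = 2 ^ k]. *)
Lemma root_bracket (k : nat) : 0 < k -> exists C, forall m, 0 < m ->
  exists w, w ^ k <= m <= C * w ^ k.
Proof.
move=> k0; exists (2 ^ k) => m m0; have [w /andP[h1 h2]] := root_floor m k0.
exists w; rewrite h1 -expnMn (leq_trans (ltnW h2)) // leq_exp2r //.
case: w h1 h2 => [|w] _ h2; last by lia.
by move: h2; rewrite exp1n ltnS leqNgt m0.
Qed.

(** The hits gain a factor [w ^ H], since [4 * (q * D) * w <= H]; the certificates cost
    [(m + m) ^ E <= w ^ (27 * E)]. As [27 * E + 1 <= H], one factor [w] remains. *)
Lemma nonramsey_rare (C w m b : nat) (T : {set 'S_m}) :
  w ^ 26 <= m <= C * w ^ 26 -> 352 + 27 * C <= w -> b = ((m + m) %/ w ^ 4).+1 ->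
  (forall s, s \in T -> ~ ramsey_K3 (matching_of s) ((m + m + (m + m)) * b)) ->
  #|T| * w <= m`!.
Proof.
move=> /andP[lo hi] large eq_b hT.
have large' : 352 <= w := leq_trans (leq_addr _ _) large.
have w0 : 0 < w := leq_trans (isT : 0 < 352) large'.
have pw a c : a <= c -> w ^ a <= w ^ c by move=> ac; rewrite leq_pexp2l.
have mulpw n a : n <= 352 -> n * w ^ a <= w ^ a.+1.
  by move=> n352; rewrite expnS leq_mul2r (leq_trans n352) ?orbT.
have pw0 a : 0 < w ^ a by rewrite expn_gt0 w0.
have [D eqD] : {D | D = w ^ 4} by exists (w ^ 4).
have [tau eqtau] : {tau | tau = w ^ 11} by exists (w ^ 11).
have [H eqH] : {H | H = w ^ 17} by exists (w ^ 17).
have [q eqq] : {q | q = 12 * tau} by exists (12 * tau).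
have tau0 : 0 < tau by rewrite eqtau.
have D0 : 0 < D by rewrite eqD.
have m0 : 0 < m by rewrite (leq_trans (pw0 26) lo).
have q0 : 0 < q by rewrite eqq muln_gt0 tau0.
have q_m : q <= m.
  by apply: leq_trans lo; rewrite eqq eqtau (leq_trans (mulpw 12 11 isT)) // pw.
have b0 : 0 < b by rewrite eq_b.
have hD : m + m <= D * b by rewrite eq_b -eqD mulnC ltnW // ltn_ceil.
have certified : T \subset [set s : 'S_m | [exists F : {ffun 'I_q * 'I_D -> 'I_(m + m)},
      exists th : {ffun 'I_(m %/ q).+1 -> 'I_m},
      H <= #|[set i | s i \in allowed F th i]|]].
  apply/subsetP=> s sT.
  have [F [th hI]] := not_ramsey_certificate eqq tau0 D0 q_m b0 hD (hT s sT).
  rewrite inE; apply/existsP; exists F; apply/existsP; exists th.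
  rewrite leqNgt; apply/negP=> small.
  have := leq_trans lo hI; rewrite leqNgt; case/negP.
  (* With fewer than [H] hits, [m] would be below [72 * w ^ 25], hence below [w ^ 26]. *)
  apply: (@leq_trans (72 * D ^ 2 * H)).
    by rewrite ltn_pmul2l // muln_gt0 expn_gt0 D0.
  by rewrite eqD eqH -expnM -mulnA -expnD; exact: mulpw.
have := leq_trans (leq_mul (subset_leq_card certified) (leqnn H`!)) (card_certified _ _ _ _).
set E := q * D + (m %/ q).+1 => cnt.
have hE : 27 * E + 1 <= H.
  have h1 : q * D = 12 * w ^ 15 by rewrite eqq eqD eqtau -mulnA -expnD.
  have h2 : m %/ q <= C * w ^ 15.
    rewrite -[leqRHS](mulnK _ q0) leq_div2r // (leq_trans hi) //.
    by rewrite -mulnA leq_mul2l eqq eqtau mulnCA -expnD leq_pmull // orbT.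
  (* Here [352 = 27 * 12 + 27 + 1], collecting [q * D], the successor in [E], and the spare unit. *)
  apply: (@leq_trans ((352 + 27 * C) * w ^ 15)); last first.
    apply: (@leq_trans (w ^ 16)); first by rewrite [leqRHS]expnS leq_mul2r large orbT.
    by rewrite eqH pw.
  move: (pw0 15) h2; rewrite /E h1; move: (w ^ 15) (m %/ q) => x y.
  by clear; nia.
have h2m : (m + m) ^ E <= w ^ (27 * E).
  have E0 : 0 < E by rewrite /E addnS.
  rewrite expnM leq_exp2r // addnn -mul2n.
  apply: (@leq_trans ((2 * C) * w ^ 26)); first by rewrite -mulnA leq_mul2l hi.
  by rewrite [leqRHS]expnS leq_mul2r (leq_trans _ large) ?orbT //; clear; lia.
have main : #|T| * H ^ H <= (m + m) ^ E * (4 * (q * D)) ^ H * m`!.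
  apply: (@leq_trans (4 ^ H * (#|T| * H`!))).
    by rewrite [leqRHS]mulnCA leq_mul2l leq_expn_self_fact orbT.
  rewrite expnMn [leqRHS](_ : _ = 4 ^ H * ((m + m) ^ E * (q * D) ^ H * m`!)); last by lia.
  rewrite leq_mul2l (leq_trans cnt) ?orbT // /E expnD -!mulnA.
  apply: leq_mul => //; apply: leq_mul => //.
  by rewrite leq_exp2r // leq_addr.
have hH : (4 * (q * D)) ^ H * w ^ H <= H ^ H.
  rewrite -expnMn leq_exp2r ?eqH // eqq eqD eqtau.
  by rewrite -[12 * _ * _]mulnA -expnD mulnA -mulnA -expnSr; exact: mulpw.
have step : #|T| * w ^ H <= (m + m) ^ E * m`!.
  have p0 : 0 < (4 * (q * D)) ^ H by rewrite expn_gt0 !muln_gt0 q0 D0.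
  rewrite -(leq_pmul2l p0) mulnCA.
  apply: (@leq_trans (#|T| * H ^ H)); first by rewrite leq_mul2l hH orbT.
  by rewrite (leq_trans main) // [leqRHS]mulnCA [leqRHS]mulnA.
rewrite -(leq_pmul2l (pw0 (27 * E))) mulnCA -expnSr -addn1.
apply: (@leq_trans (#|T| * w ^ H)); first by rewrite leq_mul2l pw ?orbT.
by rewrite (leq_trans step) // leq_mul2r h2m orbT.
Qed.

(** * Real exponents and the limit *)

Lemma asboolE (P : Prop) : asbool P <-> P.
Proof. by rewrite /asbool; case: excluded_middle_informative. Qed.

Lemma INR_leq (a b : nat) : a <= b -> (INR a <= INR b)%R.
Proof. by move=> /leP; exact: le_INR. Qed.

Lemma INR_expn (w k : nat) : INR (w ^ k) = (INR w ^ k)%R.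
Proof. by elim: k => [|k IH] //; rewrite expnS mult_INR IH. Qed.

(** Since [b * w ^ 4 <= 3 * m], the count is at most [12 * m ^ 2 / w ^ 4]. From [m <= C * w ^ 26]
    and [4 / 26 = 2 / 13], dividing by [w ^ 4] lowers the exponent of [m] from 2 to [24 / 13]. *)
Lemma vertex_count_le (C w m b : nat) :
  0 < w -> 0 < m -> w ^ 26 <= m <= C * w ^ 26 -> b = ((m + m) %/ w ^ 4).+1 ->
  (INR ((m + m + (m + m)) * b) <=
     12 * Rpower (INR C) (2 / 13) * Rpower (INR m) (24 / 13))%R.
Proof.
move=> w0 m0 /andP[lo hi] eq_b.
have w4 : 0 < w ^ 4 by rewrite expn_gt0 w0.
have w4m : w ^ 4 <= m by rewrite (leq_trans _ lo) // leq_pexp2l.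
have C0 : 0 < C by move: (leq_trans m0 hi); rewrite muln_gt0; case/andP.
have nb : (m + m + (m + m)) * b * w ^ 4 <= 12 * (m * m).
  have : b * w ^ 4 <= 3 * m.
    rewrite eq_b mulSn; have := leq_divM (m + m) (w ^ 4); move: w4m; clear.
    by move: (w ^ 4) => x; move: (_ %/ _ * _) => y; lia.
  by rewrite -mulnA; move: (b * _) => x; clear; nia.
have pos k : 0 < k -> (0 < INR k)%R by move=> /ltP; exact: lt_0_INR.
have mpos := pos m m0; have wpos := pos w w0; have Cpos := pos C C0.
have hm : (Rpower (INR m) (2 / 13) <= Rpower (INR C) (2 / 13) * INR (w ^ 4))%R.
  apply: Rle_trans (_ : Rpower (INR (C * w ^ 26)) (2 / 13) <= _)%R.
    apply: Rle_Rpower_l; first lra.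
    by split=> //; exact: INR_leq.
  rewrite mult_INR !INR_expn -Rpower_mult_distr //; last exact: pow_lt.
  rewrite -!Rpower_pow // Rpower_mult.
  right; congr (_ * Rpower _ _)%R; rewrite /=; lra.
have hr : (INR ((m + m + (m + m)) * b) * INR (w ^ 4) <= 12 * (INR m * INR m))%R.
  have := INR_leq nb; rewrite mult_INR.
  by rewrite (mult_INR 12) (mult_INR m) /=; lra.
have split_m : (INR m * INR m = Rpower (INR m) (24 / 13) * Rpower (INR m) (2 / 13))%R.
  rewrite -Rpower_plus (_ : 24 / 13 + 2 / 13 = 1 + 1)%R; last by lra.
  by rewrite Rpower_plus Rpower_1.
apply: (Rmult_le_reg_r (INR (w ^ 4))); first exact: pos.
apply: (Rle_trans _ _ _ hr); rewrite split_m.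
have pp : (0 < Rpower (INR m) (24 / 13))%R by exact: exp_pos.
have := Rmult_le_compat_l _ _ _ (Rlt_le _ _ pp) hm.
lra.
Qed.

Theorem theorem3p7 :
  exists c : R,
    Un_cv (fun m : nat => prob_ramsey_le m (c * Rpower (INR m) (24 / 13))%R) 1%R.
Proof.
have [C hC] := @root_bracket 26 isT.
exists (12 * Rpower (INR C) (2 / 13))%R => eps eps0.
have [n hn] := INR_unbounded (/ eps).
(* Any [w > W] satisfies the threshold of [nonramsey_rare] and exceeds [/ eps]; [m > C * W ^ 26]
   forces such a [w]. *)
pose W := maxn (352 + 27 * C) n.
exists (C * W ^ 26).+1 => m /leP m_large.
have m0 : 0 < m by apply: leq_trans m_large.
have [w w_m] := hC m m0.
have Ww : W < w.
  rewrite ltnNge; apply/negP=> wW; case/andP: w_m => _; rewrite leqNgt => /negP; apply.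
  by apply: leq_trans m_large; rewrite ltnS leq_mul2l leq_exp2r // wW orbT.
have large : 352 + 27 * C <= w by rewrite (leq_trans (leq_maxl _ _) (ltnW Ww)).
have w0 : 0 < w := leq_ltn_trans (leq0n _) Ww.
pose b := ((m + m) %/ w ^ 4).+1.
have count := vertex_count_le w0 m0 w_m (erefl b).
rewrite /prob_ramsey_le; set x := (_ * Rpower (INR m) _)%R in count *.
set S := [set s : 'S_m | _].
have rare : #|~: S| * w <= m`!.
  apply: (nonramsey_rare w_m large (erefl b)) => s; rewrite !inE => /negP nS ram.
  by apply: nS; apply/asboolE; exists ((m + m + (m + m)) * b).
have card_S : #|S| + #|~: S| = m`! by rewrite cardsC card_Sn.
have fpos : (0 < INR m`!)%R by apply: lt_0_INR; apply/ltP; exact: fact_gt0.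
have eps_w : (1 < eps * INR w)%R.
  have inv_lt : (/ eps < INR w)%R.
    apply: (Rlt_le_trans _ _ _ hn).
    by apply: INR_leq; rewrite (leq_trans (leq_maxr _ _) (ltnW Ww)).
  by have := Rmult_lt_compat_l _ _ _ eps0 inv_lt; rewrite Rinv_r; lra.
have := INR_leq rare; rewrite mult_INR.
have : (INR #|S| + INR #|~: S| = INR m`!)%R by rewrite -plus_INR -card_S.
move: fpos (pos_INR #|~: S|); set f := INR m`!; set y := INR #|~: S|.
move=> fpos y0 sum_f yw.
rewrite /R_dist (_ : INR #|S| / f - 1 = - (y / f))%R; last first.
  by rewrite (_ : INR #|S| = f - y)%R; [field; lra | lra].
rewrite Rabs_Ropp Rabs_pos_eq; last exact: Rle_mult_inv_pos.
apply: (Rmult_lt_reg_r f) => //; rewrite /Rdiv Rmult_assoc Rinv_l ?Rmult_1_r; last by lra.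
(* The strict bound comes from multiplying [1 < eps * INR w] by [y], so [y = 0] is treated apart. *)
have [->|yp] : (y = 0 \/ 0 < y)%R by lra.
  exact: Rmult_lt_0_compat.
apply: (Rlt_le_trans _ (y * (eps * INR w))); last by nra.
by rewrite -{1}[y]Rmult_1_r; apply: Rmult_lt_compat_l.
Qed.
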